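(* For every parameter $a=\Delta^s_{a_1a_2\ldots a_n\ldots}\in[0,1]$ (with $(a_n)\in L$ its fixed $s$-adic digit sequence), the function $f_a$ is continuous at every $Q^*_s$-unary point of $[0,1]$. Moreover, $f_a$ is continuous at every $Q^*_s$-binary point if and only if $a=0$ or $a=1$.
   Context: Let $s\ge 2$ be an integer, $A=\{0,1,\dots,s-1\}$, and $L=A\times A\times\cdots$ the set of infinite sequences with elements in $A$. Fix numbers $q_{in}$ ($i\in A$, $n\in\mathbb{N}=\{1,2,\dots\}$) with $0<q_{in}<1$, $q_{0n}+q_{1n}+\dots+q_{s-1,n}=1$ for every $n$, and $\prod_{n=1}^\infty\max_{i\in A} q_{in}=0$; moreover assume there are constants $\varepsilon,\delta$ with $0<\varepsilon<\min_i q_{in}$ and $\max_i q_{in}<\delta<1$ for all $n\in\mathbb{N}$. Put $\beta_{in}=\sum_{k=0}^{i-1}q_{kn}$ (so $\beta_{0n}=0$). For $(\alpha_n)\in L$ define $$\Delta^{Q^*_s}_{\alpha_1\alpha_2\ldots\alpha_n\ldots}=\beta_{\alpha_1 1}+\sum_{n=2}^\infty\Bigl(\beta_{\alpha_n n}\prod_{j=1}^{n-1}q_{\alpha_j j}\Bigr).$$ Every $x\in[0,1]$ equals $\Delta^{Q^*_s}_{\alpha_1\alpha_2\ldots}$ for some $(\alpha_n)\in L$, called a $Q^*_s$-representation of $x$. Parentheses denote a period. The numbers with two representations are exactly those of the form $\Delta^{Q^*_s}_{\alpha_1\ldots\alpha_{m-1}\alpha_m(0)}=\Delta^{Q^*_s}_{\alpha_1\ldots\alpha_{m-1}[\alpha_m-1](s-1)}$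 with $\alpha_m\ge 1$ ($Q^*_s$-binary numbers); all other numbers of $[0,1]$ have a unique representation ($Q^*_s$-unary numbers). For $(a_n)\in L$ let $a=\Delta^s_{a_1a_2\ldots}=\sum_{n\ge1}a_n s^{-n}\in[0,1]$ be the number with this (fixed) $s$-adic digit sequence. The function $f_a:[0,1]\to[0,1]$ is $$f_a\bigl(\Delta^{Q^*_s}_{\alpha_1\alpha_2\ldots\alpha_n\ldots}\bigr)=\Delta^{Q^*_s}_{|a_1-\alpha_1|\,|a_2-\alpha_2|\ldots|a_n-\alpha_n|\ldots},$$ where for a $Q^*_s$-binary argument the formula is applied to its representation with period $(0)$, and for a $Q^*_s$-unary argument to its unique representation. Continuity at a point means continuity of $f_a$ as a function on $[0,1]$. *)

(* Defs.v *)
From mathcomp Require Import all_boot all_order all_algebra.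
From mathcomp Require Import all_classical all_reals all_analysis.
Set Implicit Arguments.
Unset Strict Implicit.
Unset Printing Implicit Defensive.
Import Order.TTheory GRing.Theory Num.Theory.
Import numFieldNormedType.Exports.
Local Open Scope classical_set_scope.
Local Open Scope ring_scope.

(* Positions are numbered from 0: [alpha n] is the mathematical digit
   alpha_{n+1}, and [q i n] is q_{i,n+1}. *)
Definition digits (s : nat) := nat -> 'I_s.

(* The neutral elements 0 and 1 are harmless: every q_{in} lies in ]0, 1[. *)
Definition maxq (R : realType) (s : nat) (q : 'I_s -> nat -> R) (n : nat) : R :=
  \big[Num.max/0]_(i < s) q i n.
Definition minq (R : realType) (s : nat) (q : 'I_s -> nat -> R) (n : nat) : R :=
  \big[Num.min/1]_(i < s) q i n.

Definition beta (R : realType) (s : nat) (q : 'I_s -> nat -> R)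
    (i : 'I_s) (n : nat) : R :=
  \sum_(k < s | (k < i)%N) q k n.

Definition Delta (R : realType) (s : nat) (q : 'I_s -> nat -> R)
    (alpha : digits s) : R :=
  limn (series (fun n => beta q (alpha n) n * \prod_(j < n) q (alpha j) j)).

Definition sadic (R : realType) (s : nat) (a : digits s) : R :=
  limn (series (fun n => (a n)%:R / s%:R ^+ n.+1 : R)).

Definition period0 (s : nat) (alpha : digits s) : Prop :=
  exists m, forall n, (m <= n)%N -> alpha n = 0%N :> nat.

Definition Qbinary (R : realType) (s : nat) (q : 'I_s -> nat -> R) (x : R) :
    Prop :=
  exists (alpha : digits s) (m : nat),
    [/\ (1 <= alpha m)%N,
        forall n, (m < n)%N -> alpha n = 0%N :> nat
      & x = Delta q alpha].

Definition Qunary (R : realType) (s : nat) (q : 'I_s -> nat -> R) (x : R) :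
    Prop :=
  0 <= x <= 1 /\ exists! alpha : digits s, x = Delta q alpha.

Lemma absdiff_subproof (s : nat) (i j : 'I_s) : ((i - j) + (j - i) < s)%N.
Proof.
case: (leqP i j) => [le_ij|/ltnW le_ji].
  by rewrite (eqP le_ij) add0n (leq_ltn_trans (leq_subr _ _)).
by rewrite (eqP le_ji) addn0 (leq_ltn_trans (leq_subr _ _)).
Qed.

(* |i - j|: one of the two truncated differences is always 0. *)
Definition absdiff (s : nat) (i j : 'I_s) : 'I_s :=
  Ordinal (absdiff_subproof i j).

Definition preferred_rep (R : realType) (s : nat) (q : 'I_s -> nat -> R)
    (x : R) : set (digits s) :=
  [set alpha | x = Delta q alpha /\ (Qbinary q x -> period0 alpha)].

(* Each x in [0, 1] has exactly one preferred representation, so the image set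
   below is a singleton there; the value 0 is only used outside [0, 1]. *)
Definition f_ (R : realType) (s : nat) (q : 'I_s -> nat -> R) (a : digits s)
    (x : R) : R :=
  xget 0 [set Delta q (fun n => absdiff (a n) (alpha n))
         | alpha in preferred_rep q x].

Definition continuous_on_at (R : realType) (A : set R) (f : R -> R) (x : R) :
    Prop :=
  f y @[y --> within A (nbhs x)] --> f x.

(* Main.v *)
Require Import Defs.
From mathcomp Require Import all_boot all_order all_algebra.
From mathcomp Require Import all_classical all_reals all_analysis.
From mathcomp Require Import zify lra.
Set Implicit Arguments.
Unset Strict Implicit.
Unset Printing Implicit Defensive.
Import Order.TTheory GRing.Theory Num.Theory.
Import numFieldNormedType.Exports.
Local Open Scope classical_set_scope.
Local Open Scope ring_scope.

(** The first [n] digits of a representation confine the represented number to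
a closed cylinder, an interval [[lo, hi]] whose width is the product of the
chosen weights. Cylinders of the same rank do not overlap and their widths tend
to 0, so two digit sequences represent the same number only if they are equal
or are twins: one continues with the largest digit for ever, the other with 0,
after two neighbouring digits ([Delta_eq]). It also follows that a number
strictly inside a cylinder has all its representations in it ([open_cylinder]).

The map on digit sequences that underlies [f_], namely [alpha |-> |a - alpha|]
digit by digit, preserves common prefixes. Hence [f_] has one-sided limits
everywhere: if [alpha] does not end in largest digits, an argument approaching
[Delta alpha] from the right gets trapped in every cylinder of [alpha], so the
limit is the value computed from [alpha] ([right_limit]); symmetrically from
the left if [alpha] does not end in zeros ([left_limit]). At a unary point a
single sequence serves both sides (or the point is an endpoint of [[0, 1]]),
which gives continuity. At a binary point the two sides are served by the two
twins, so [f_] is continuous there exactly if the images of the twins under the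
digit map represent the same number ([continuous_binary]).

If all digits [a n] are 0 the digit map is the identity, and if all are the
largest digit it exchanges the twins; both preserve equality of the represented
numbers. Conversely, only the points [Delta (c 0 0 ...)] with [c <> 0] need be
tested. The images of the twins have distinct first digits, hence are twins
themselves, and reading off their tails forces [a 1, a 2, ...] to be all 0 with
[a 0 < c], or all largest with [c <= a 0] ([first_digit_test]). Taking [c = 1]
and then the largest [c] leaves only the two constant sequences. These are the
expansions of 0 and 1, since the [s]-adic expansion is the case of equal
weights ([sadicE]). *)

(** * Digit sequences *)

Section DigitSequences.
Variable p : nat.
Implicit Types alpha gamma : digits p.+2.

Definition agree (n : nat) alpha gamma : Prop :=
  forall k, (k < n)%N -> alpha k = gamma k.

Lemma agree_sym n alpha gamma : agree n alpha gamma -> agree n gamma alpha.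
Proof. by move=> h k /h. Qed.

Lemma agreeW m n alpha gamma :
  (m <= n)%N -> agree n alpha gamma -> agree m alpha gamma.
Proof. by move=> mn h k km; apply: h; apply: leq_trans mn. Qed.

Definition splits_at (k : nat) alpha gamma : Prop :=
  agree k alpha gamma /\ (alpha k < gamma k)%N.

Lemma agree_or_splits n alpha gamma : agree n alpha gamma \/
  exists2 k, (k < n)%N & splits_at k alpha gamma \/ splits_at k gamma alpha.
Proof.
elim: n => [|n [IH|[k kn h]]]; first by left.
  case: (ltngtP (alpha n) (gamma n)) => [lt|lt|/val_inj e].
  - by right; exists n => //; left.
  - by right; exists n => //; right; split=> //; apply: agree_sym.
  - by left=> k; rewrite ltnS leq_eqVlt => /predU1P[->|/IH].
by right; exists k => //; apply: ltnW.
Qed.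

Lemma eq_or_splits alpha gamma : alpha = gamma \/
  exists k, splits_at k alpha gamma \/ splits_at k gamma alpha.
Proof.
have [|/existsNP[n ne]] := pselect (forall n, alpha n = gamma n).
  by move=> /funext; left.
right; have [h|[k _ h]] := agree_or_splits n.+1 alpha gamma; last by exists k.
by case: ne; apply: h.
Qed.

(** The two representations of a binary number, the one with the smaller digit
at position [m], hence ending in largest digits, first. *)
Definition twins (m : nat) alpha gamma : Prop :=
  [/\ agree m alpha gamma, gamma m = (alpha m).+1 :> nat,
      forall n, (m < n)%N -> alpha n = ord_max
    & forall n, (m < n)%N -> gamma n = ord0].

Definition upper_twin (m : nat) alpha : digits p.+2 := fun n =>
  if (n < m)%N then alpha n else if n == m then inord (alpha m).+1 else ord0.

Definition lower_twin (m : nat) alpha : digits p.+2 := fun n =>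
  if (n < m)%N then alpha n else if n == m then inord (alpha m).-1 else ord_max.

Lemma twins_upper m alpha : alpha m != ord_max ->
  (forall n, (m < n)%N -> alpha n = ord_max) ->
  twins m alpha (upper_twin m alpha).
Proof.
rewrite -val_eqE /= => nmax tail; rewrite /upper_twin; split=> //.
- by move=> k ->.
- rewrite ltnn eqxx inordK //; have := ltn_ord (alpha m); lia.
- by move=> n mn; rewrite ltnNge (ltnW mn) /= gtn_eqF.
Qed.

Lemma twins_lower m alpha : alpha m != ord0 ->
  (forall n, (m < n)%N -> alpha n = ord0) ->
  twins m (lower_twin m alpha) alpha.
Proof.
rewrite -val_eqE /= => n0 tail; rewrite /lower_twin; split=> //.
- by move=> k ->.
- rewrite ltnn eqxx inordK; have := ltn_ord (alpha m); lia.
- by move=> n mn; rewrite ltnNge (ltnW mn) /= gtn_eqF.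
Qed.

(** Applied to an eventually constant sequence, this finds the position [m] at
which a twin can be built, unless the sequence is constant. *)
Lemma last_exception (c : 'I_p.+2) n alpha :
  (forall k, (n <= k)%N -> alpha k = c) -> (forall k, alpha k = c) \/
  exists m, alpha m != c /\ forall k, (m < k)%N -> alpha k = c.
Proof.
elim: n => [|n IH] h; first by left=> k; apply: h.
have [e|ne] := eqVneq (alpha n) c; last by right; exists n.
by apply: IH => k; rewrite leq_eqVlt => /predU1P[<-|/h].
Qed.

End DigitSequences.

(** * Cylinders *)

Section Cylinders.
Variables (R : realType) (p : nat) (q : 'I_p.+2 -> nat -> R).
Hypothesis q01 : forall i n, 0 < q i n < 1.
Hypothesis qsum : forall n, \sum_(i < p.+2) q i n = 1.
Implicit Types alpha gamma : digits p.+2.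

(** [beta] with a natural number as upper limit: the digit [i] then occupies the
interval from [cum i n] to [cum i.+1 n], also when [i] is the largest digit. *)
Definition cum (m n : nat) : R := \sum_(k < p.+2 | (k < m)%N) q k n.

(** Width, left end and right end of the cylinder of the first [n] digits. *)
Definition wd alpha n : R := \prod_(j < n) q (alpha j) j.

Definition lo alpha : nat -> R :=
  series (fun n => beta q (alpha n) n * \prod_(j < n) q (alpha j) j).

Definition hi alpha n : R := lo alpha n + wd alpha n.

Lemma q_gt0 i n : 0 < q i n. Proof. by have /andP[] := q01 i n. Qed.

Lemma cum0 n : cum 0 n = 0. Proof. exact: big_pred0. Qed.

Lemma cum_full n : cum p.+2 n = 1.
Proof. by rewrite /cum -(qsum n); apply: eq_bigl => k; rewrite ltn_ord. Qed.

Lemma cumS (i : 'I_p.+2) n : cum i.+1 n = cum i n + q i n.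
Proof.
rewrite /cum (bigD1 i) //= addrC; congr (_ + _); apply: eq_bigl => k.
by rewrite ltnS [RHS]ltn_neqAle andbC -val_eqE.
Qed.

Lemma cum_lt m m' n : (m < m')%N -> (m' <= p.+2)%N -> cum m n < cum m' n.
Proof.
elim: m' => [//|m' IH]; rewrite ltnS => mm' m'p.
rewrite (cumS (Ordinal m'p)).
have q0 := q_gt0 (Ordinal m'p) n.
move: mm'; rewrite leq_eqVlt => /predU1P[->|lt].
  by rewrite ltrDl.
by apply: lt_trans (IH lt (ltnW m'p)) _; rewrite ltrDl.
Qed.

Lemma cum_le m m' n : (m <= m')%N -> (m' <= p.+2)%N -> cum m n <= cum m' n.
Proof. by rewrite leq_eqVlt => /predU1P[->//|h h']; apply/ltW/cum_lt. Qed.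

Lemma cum_inj m m' n : (m <= p.+2)%N -> (m' <= p.+2)%N ->
  cum m n = cum m' n -> m = m'.
Proof.
move=> mp m'p e; case: (ltngtP m m') => // lt.
  by have := cum_lt n lt m'p; rewrite e ltxx.
by have := cum_lt n lt mp; rewrite e ltxx.
Qed.

Lemma wd_gt0 alpha n : 0 < wd alpha n.
Proof. by apply: prodr_gt0 => j _; apply: q_gt0. Qed.

Lemma wdS alpha n : wd alpha n.+1 = wd alpha n * q (alpha n) n.
Proof. by rewrite /wd big_ord_recr. Qed.

Lemma loS alpha n : lo alpha n.+1 = lo alpha n + cum (alpha n) n * wd alpha n.
Proof. by rewrite /lo seriesSr. Qed.

Lemma hiS alpha n :
  hi alpha n.+1 = lo alpha n + cum (alpha n).+1 n * wd alpha n.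
Proof. by rewrite /hi loS wdS cumS mulrDl addrA [wd _ _ * _]mulrC. Qed.

Lemma lo0 alpha : lo alpha 0 = 0.
Proof. by rewrite /lo /series /= big_geq. Qed.

Lemma hi0 alpha : hi alpha 0 = 1.
Proof. by rewrite /hi lo0 add0r /wd big_ord0. Qed.

Lemma lo_le alpha m n : (m <= n)%N -> lo alpha m <= lo alpha n.
Proof.
move: m n; apply/nondecreasing_seqP => n.
by rewrite loS lerDl mulr_ge0 ?(ltW (wd_gt0 _ _)) // -(cum0 n) cum_le // ltnW.
Qed.

Lemma hi_le alpha m n : (m <= n)%N -> hi alpha n <= hi alpha m.
Proof.
move: m n; apply/nonincreasing_seqP => n.
rewrite hiS lerD2l -[leRHS]mul1r ler_wpM2r ?(ltW (wd_gt0 _ _)) //.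
by rewrite -(cum_full n) cum_le.
Qed.

Lemma lo_lt_hi alpha n : lo alpha n < hi alpha n.
Proof. by rewrite ltrDl wd_gt0. Qed.

Lemma lo_cvg alpha : cvgn (lo alpha).
Proof.
apply: nondecreasing_is_cvgn; first by move=> m n /lo_le.
exists 1 => _ [n _ <-]; rewrite -(hi0 alpha).
by apply: (le_trans _ (hi_le alpha (leq0n n))); apply/ltW/lo_lt_hi.
Qed.

Lemma lo_le_Delta alpha n : lo alpha n <= Delta q alpha.
Proof.
by apply: nondecreasing_cvgn_le (@lo_cvg alpha) n; move=> ? ? /lo_le.
Qed.

Lemma Delta_le_hi alpha n : Delta q alpha <= hi alpha n.
Proof.
apply: limr_le; first exact: lo_cvg.
by exists n => // m /= /(hi_le alpha); apply: le_trans; apply/ltW/lo_lt_hi.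
Qed.

Lemma Delta01 alpha : 0 <= Delta q alpha <= 1.
Proof. by rewrite -{1}(lo0 alpha) -(hi0 alpha) lo_le_Delta Delta_le_hi. Qed.

Lemma agree_wd n alpha gamma : agree n alpha gamma -> wd alpha n = wd gamma n.
Proof. by move=> h; apply: eq_bigr => j _; rewrite h. Qed.

Lemma agree_lo n alpha gamma : agree n alpha gamma -> lo alpha n = lo gamma n.
Proof.
elim: n => [|n IH] h; first by rewrite !lo0.
have h' := agreeW (leqnSn n) h.
by rewrite !loS IH // (agree_wd h') (h n).
Qed.

Lemma agree_hi n alpha gamma : agree n alpha gamma -> hi alpha n = hi gamma n.
Proof. by move=> h; rewrite /hi (agree_lo h) (agree_wd h). Qed.

(** The cylinder after the smaller digit lies to the left of the one after the
larger digit, and they touch only if the digits are neighbours. *)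
Lemma splits_hi_le_lo k alpha gamma : splits_at k alpha gamma ->
  hi alpha k.+1 <= lo gamma k.+1 ?= iff (gamma k == (alpha k).+1 :> nat).
Proof.
move=> [h lt]; rewrite hiS loS (agree_lo h) (agree_wd h); split.
  rewrite lerD2l ler_wpM2r ?(ltW (wd_gt0 _ _)) //.
  by apply: cum_le => //; apply: ltnW.
apply/eqP/eqP => [/addrI /(mulIf (lt0r_neq0 (wd_gt0 _ _)))|-> //].
by move=> /cum_inj -> //; apply: ltnW.
Qed.

(** A sequence that leaves [alpha] before position [n] lies in a cylinder beside
that of [alpha], which at best touches its ends. *)
Lemma open_cylinder n alpha gamma :
  lo alpha n < Delta q gamma < hi alpha n -> agree n alpha gamma.
Proof.
move=> /andP[h1 h2]; have [//|[k kn [sp|sp]]] := agree_or_splits n alpha gamma.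
  have [h _] := splits_hi_le_lo sp.
  have := lt_le_trans h2 (le_trans (hi_le _ kn) (le_trans h (lo_le_Delta _ _))).
  by rewrite ltxx.
have [h _] := splits_hi_le_lo sp.
have := le_trans (Delta_le_hi _ k.+1) (le_trans h (lo_le _ kn)).
move=> /(lt_le_trans h1).
by rewrite ltxx.
Qed.

Lemma agree_dist n alpha gamma : agree n alpha gamma ->
  `|Delta q alpha - Delta q gamma| <= wd alpha n.
Proof.
move=> h; have := (lo_le_Delta alpha n, Delta_le_hi alpha n).
have := (lo_le_Delta gamma n, Delta_le_hi gamma n).
rewrite -(agree_hi h) -(agree_lo h) /hi => -[h1 h2] [h3 h4].
rewrite ler_norml; lra.
Qed.

(** Left ends increase towards the value, and each nonzero digit moves them. *)
Lemma lo_const n alpha : lo alpha n = Delta q alpha ->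
  forall k, (n <= k)%N -> alpha k = ord0.
Proof.
move=> e k nk; have := lo_le_Delta alpha k.+1; have := lo_le alpha nk.
rewrite -e => h; rewrite loS => h'.
have : cum (alpha k) k * wd alpha k <= 0 by lra.
rewrite pmulr_lle0 ?wd_gt0 // => c; apply: val_inj => /=.
apply/eqP; rewrite -leqn0 leqNgt; apply/negP => /(cum_lt k).
by rewrite cum0 => /(_ (ltnW (ltn_ord _))); rewrite ltNge c.
Qed.

(** Right ends decrease towards the value, and a digit that is not largest
selects a cylinder that falls short of the previous right end. *)
Lemma hi_const n alpha : hi alpha n = Delta q alpha ->
  forall k, (n <= k)%N -> alpha k = ord_max.
Proof.
move=> e k nk; have := Delta_le_hi alpha k.+1; have := hi_le alpha nk.
rewrite -e hiS /hi => h h'; apply: val_inj => /=; apply/eqP.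
rewrite -eqSS eqn_leq ltn_ord leqNgt; apply/negP => /(cum_lt k)/(_ (leqnn _)).
rewrite cum_full => lt; have := wd_gt0 alpha k.
move: (cum _ _) lt h' => c lt h' w0; nra.
Qed.

(* The cylinders around a sequence then shrink to the point it represents. *)
Hypothesis shrink : forall alpha, wd alpha n @[n --> \oo] --> (0 : R).

Lemma le_wd_eventually n alpha (x y : R) :
  (forall k, (n <= k)%N -> x <= y + wd alpha k) -> x <= y.
Proof.
move=> h; apply/ler_addgt0Pr => e e0.
have [N _ hN] := cvgr0_norm_lt _ (@shrink alpha) _ e0.
have := hN (maxn n N) (leq_maxr _ _).
rewrite /= gtr0_norm ?wd_gt0 // => /ltW he.
by apply: le_trans (h _ (leq_maxl n N)) _; rewrite lerD2l.
Qed.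

Lemma zero_tail n alpha : (forall k, (n <= k)%N -> alpha k = ord0) ->
  Delta q alpha = lo alpha n.
Proof.
move=> h; apply/eqP; rewrite eq_le lo_le_Delta andbT.
apply: (@le_wd_eventually n alpha) => k nk.
suff -> : lo alpha n = lo alpha k by apply: Delta_le_hi.
elim: k nk => [|k IH]; first by rewrite leqn0 => /eqP->.
rewrite leq_eqVlt => /predU1P[->//|nk].
by rewrite loS h // cum0 mul0r addr0 IH.
Qed.

Lemma max_tail n alpha : (forall k, (n <= k)%N -> alpha k = ord_max) ->
  Delta q alpha = hi alpha n.
Proof.
move=> h; apply/eqP; rewrite eq_le Delta_le_hi /=.
apply: (@le_wd_eventually n alpha) => k nk.
suff -> : hi alpha n = hi alpha k by rewrite lerD2r lo_le_Delta.
elim: k nk => [|k IH]; first by rewrite leqn0 => /eqP->.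
rewrite leq_eqVlt => /predU1P[->//|nk].
by rewrite hiS h // cum_full mul1r IH.
Qed.

Lemma twins_Delta m alpha gamma :
  twins m alpha gamma -> Delta q alpha = Delta q gamma.
Proof.
move=> [h e t1 t2]; rewrite (max_tail t1) (zero_tail t2); apply/eqP.
by rewrite (splits_hi_le_lo (conj h _)) e ?ltnSn.
Qed.

(** Equality squeezes the touching ends of the two cylinders onto the common
value, so the lower sequence stays at right ends and the upper at left ends. *)
Lemma splits_eq_twins k alpha gamma : splits_at k alpha gamma ->
  Delta q alpha = Delta q gamma -> twins k alpha gamma.
Proof.
move=> sp e; have [h eqc] := splits_hi_le_lo sp.
have h1 := Delta_le_hi alpha k.+1; have h2 := lo_le_Delta gamma k.+1.
have e1 : hi alpha k.+1 = Delta q alpha.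
  by apply/eqP; rewrite eq_le h1 andbT e (le_trans h).
have e2 : lo gamma k.+1 = Delta q gamma.
  by apply/eqP; rewrite eq_le h2 /= -e (le_trans h1).
split; [exact: sp.1| |exact: hi_const e1|exact: lo_const e2].
by apply/eqP; rewrite -eqc e1 e2 e.
Qed.

Lemma Delta_eq alpha gamma : Delta q alpha = Delta q gamma ->
  alpha = gamma \/ exists m, twins m alpha gamma \/ twins m gamma alpha.
Proof.
move=> e; have [|[k sp]] := eq_or_splits alpha gamma; first by left.
by right; exists k; case: sp => /splits_eq_twins h; [left|right]; apply: h.
Qed.

Lemma digit_exists n (r : R) : 0 <= r <= 1 ->
  exists i : 'I_p.+2, cum i n <= r <= cum i.+1 n.
Proof.
move=> /andP[r0 r1].
have P0 : cum (ord0 : 'I_p.+2) n <= r by rewrite cum0.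
pose P := [pred i : 'I_p.+2 | cum i n <= r].
have [i Pi imax] := @arg_maxnP _ (ord0 : 'I_p.+2) P (fun i => nat_of_ord i) P0.
exists i; rewrite [cum i n <= r]Pi /=.
have [lt|ge] := ltnP i.+1 p.+2; last first.
  by apply: le_trans r1 _; rewrite -(cum_full n) cum_le.
rewrite leNgt; apply/negP => /ltW h.
by have := imax (Ordinal lt) h; rewrite /= ltnn.
Qed.

(** Digits are chosen one at a time: [r n] in [[0, 1]] is the relative position
of [y] in its cylinder of rank [n], and the next digit is any one whose interval
contains [r n]. *)
Lemma Delta_surj (y : R) : 0 <= y <= 1 -> exists alpha, y = Delta q alpha.
Proof.
move=> y01.
have dig n (r : R) : {i : 'I_p.+2 | 0 <= r <= 1 -> cum i n <= r <= cum i.+1 n}.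
  apply: cid; have [/(digit_exists n)[i h]|h] := pselect (0 <= r <= 1).
    by exists i.
  by exists ord0.
pose d n r := sval (dig n r).
pose fix r n : R := if n is m.+1
  then (r m - cum (d m (r m)) m) / q (d m (r m)) m else y.
pose alpha n := d n (r n).
have r01 n : 0 <= r n <= 1.
  elim: n => [//|n /(svalP (dig n (r n)))]; rewrite -/(d n (r n)) /= cumS.
  have := q_gt0 (d n (r n)) n.
  move: (d n (r n)) => i q0 /andP[h1 h2].
  rewrite divr_ge0 ?(ltW q0) ?subr_ge0 //= ler_pdivrMr // mul1r; lra.
have yE n : y = lo alpha n + wd alpha n * r n.
  elim: n => [|n ->]; first by rewrite lo0 /wd big_ord0 mul1r add0r.
  rewrite loS wdS -/(alpha n) /= -/(alpha n); have := q_gt0 (alpha n) n.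
  move: (q _ _) => c /lt0r_neq0 c0.
  by rewrite -!mulrA [c * _]mulrC -mulrA mulVf // mulr1; lra.
exists alpha; apply/eqP; rewrite eq_le.
apply/andP; split; apply: (@le_wd_eventually 0 alpha) => k _.
  rewrite {1}(yE k); apply: lerD; first exact: lo_le_Delta.
  by rewrite ler_piMr ?(ltW (wd_gt0 _ _)) //; have /andP[] := r01 k.
apply: le_trans (Delta_le_hi _ k) _; rewrite lerD2r [leRHS](yE k) lerDl.
by rewrite mulr_ge0 ?(ltW (wd_gt0 _ _)) //; have /andP[] := r01 k.
Qed.

(** * One-sided limits *)

Section DigitwiseMap.
Variable g : digits p.+2 -> digits p.+2.
Hypothesis g_agree : forall n alpha gamma,
  agree n alpha gamma -> agree n (g alpha) (g gamma).

Lemma g_near alpha (e : R) : 0 < e -> exists n, forall gamma,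
  agree n alpha gamma -> `|Delta q (g alpha) - Delta q (g gamma)| < e.
Proof.
move=> e0; have [N _ hN] := cvgr0_norm_lt _ (@shrink (g alpha)) _ e0.
exists N => gamma /g_agree/agree_dist/le_lt_trans; apply.
by have := hN N (leqnn N); rewrite /= gtr0_norm ?wd_gt0.
Qed.

(** If [alpha] does not end in largest digits, its value is not the right end of
any of its cylinders, so numbers slightly to the right stay inside them. *)
Lemma right_limit alpha : (forall n, Delta q alpha < hi alpha n) ->
  forall e : R, 0 < e -> exists2 d, 0 < d & forall gamma,
  Delta q alpha < Delta q gamma < Delta q alpha + d ->
  `|Delta q (g alpha) - Delta q (g gamma)| < e.
Proof.
move=> lt e /(g_near alpha)[n hn]; exists (hi alpha n - Delta q alpha).
  by rewrite subr_gt0.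
move=> gamma /andP[h1 h2]; apply/hn/open_cylinder.
by rewrite (le_lt_trans (lo_le_Delta _ _) h1); lra.
Qed.

Lemma left_limit alpha : (forall n, lo alpha n < Delta q alpha) ->
  forall e : R, 0 < e -> exists2 d, 0 < d & forall gamma,
  Delta q alpha - d < Delta q gamma < Delta q alpha ->
  `|Delta q (g alpha) - Delta q (g gamma)| < e.
Proof.
move=> lt e /(g_near alpha)[n hn]; exists (Delta q alpha - lo alpha n).
  by rewrite subr_gt0.
move=> gamma /andP[h1 h2]; apply/hn/open_cylinder.
by rewrite (lt_le_trans h2 (Delta_le_hi _ _)) andbT; lra.
Qed.

End DigitwiseMap.

End Cylinders.

Lemma continuous_on_atP (R : realType) (A : set R) (f : R -> R) (x : R) :
  continuous_on_at A f x <-> forall e, 0 < e -> exists2 d, 0 < d &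
    forall y, A y -> `|x - y| < d -> `|f x - f y| < e.
Proof.
rewrite /continuous_on_at; split.
  move=> /cvgrPdist_lt h e /h; rewrite near_withinE => /nbhs_normP[d /= d0 hd].
  by exists d => // y Ay xy; apply: hd.
move=> h; apply/cvgrPdist_lt => e /h[d d0 hd]; rewrite near_withinE.
by apply/nbhs_normP; exists d => // y /= xy Ay; apply: hd.
Qed.

(** * The function at unary and binary points *)

Section DigitDistance.
Variables (R : realType) (p : nat) (q : 'I_p.+2 -> nat -> R).
Hypothesis q01 : forall i n, 0 < q i n < 1.
Hypothesis qsum : forall n, \sum_(i < p.+2) q i n = 1.
Hypothesis shrink : forall alpha, wd q alpha n @[n --> \oo] --> (0 : R).
Variable a : digits p.+2.
Implicit Types alpha gamma : digits p.+2.

Definition digit_dist alpha : digits p.+2 := fun n => absdiff (a n) (alpha n).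

Lemma digit_dist_agree n alpha gamma :
  agree n alpha gamma -> agree n (digit_dist alpha) (digit_dist gamma).
Proof. by move=> h k /h; rewrite /digit_dist => ->. Qed.

Lemma twins_Qbinary m alpha gamma :
  twins m alpha gamma -> Qbinary q (Delta q gamma).
Proof.
move=> [_ e _ t]; exists gamma, m; split=> //; first by rewrite e.
by move=> n /t ->.
Qed.

Lemma twins_not_preferred m alpha gamma : twins m alpha gamma ->
  ~ preferred_rep q (Delta q gamma) alpha.
Proof.
move=> tw [_ /(_ (twins_Qbinary tw))[N z]]; case: tw => [_ _ t _].
have := z (maxn N m.+1) (leq_maxl _ _).
by rewrite t ?leq_maxr.
Qed.

Lemma preferred_zero_tail m alpha : (forall n, (m < n)%N -> alpha n = ord0) ->
  preferred_rep q (Delta q alpha) alpha.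
Proof. by move=> t; split=> // _; exists m.+1 => n /t ->. Qed.

(** Of two twins only the one ending in zeros is preferred, as the common value
is binary. *)
Lemma preferred_uniq x alpha gamma :
  preferred_rep q x alpha -> preferred_rep q x gamma -> alpha = gamma.
Proof.
move=> pa pg; have ea := pa.1; have eg := pg.1.
have [//|[m [tw|tw]]] :=
    Delta_eq q01 qsum (etrans (esym ea) eg).
  by case: (twins_not_preferred tw); rewrite -eg.
by case: (twins_not_preferred tw); rewrite -ea.
Qed.

Lemma preferred_exists x : 0 <= x <= 1 -> exists alpha, preferred_rep q x alpha.
Proof.
move=> x01; have [[alpha [m [_ t e]]]|nb] := pselect (Qbinary q x).
  exists alpha; rewrite e; apply: preferred_zero_tail => n /t h.
  exact: val_inj.
by have [alpha e] := Delta_surj q01 qsum shrink x01; exists alpha.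
Qed.

Lemma f_E x alpha :
  preferred_rep q x alpha -> f_ q a x = Delta q (digit_dist alpha).
Proof.
move=> pa; apply: xget_subset1; first by exists alpha.
by move=> _ _ [b pb <-] [c pc <-]; rewrite (preferred_uniq pb pc).
Qed.

(** [alpha] controls the approach from the left and [gamma] that from the right;
at an endpoint of [[0, 1]] one of the approaches is void. *)
Lemma continuous_two_sided x alpha gamma :
  x = Delta q alpha -> x = Delta q gamma ->
  f_ q a x = Delta q (digit_dist alpha) ->
  f_ q a x = Delta q (digit_dist gamma) ->
  (forall n, lo q alpha n < x) \/ x = 0 ->
  (forall n, x < hi q gamma n) \/ x = 1 ->
  continuous_on_at `[0, 1] (f_ q a) x.
Proof.
move=> ea eg fa fg L U; apply/continuous_on_atP => e e0.
have [d1 d10 h1] : exists2 d, 0 < d & forall b, x - d < Delta q b < x ->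
    `|f_ q a x - Delta q (digit_dist b)| < e.
  case: L => [L|->].
    rewrite fa ea; apply: left_limit => // [|n]; last by rewrite -ea.
    exact: digit_dist_agree.
  exists 1 => // b /andP[_]; have /andP[b0 _] := Delta01 q01 qsum b.
  by rewrite ltNge b0.
have [d2 d20 h2] : exists2 d, 0 < d & forall b, x < Delta q b < x + d ->
    `|f_ q a x - Delta q (digit_dist b)| < e.
  case: U => [U|->].
    rewrite fg eg; apply: right_limit => // [|n]; last by rewrite -eg.
    exact: digit_dist_agree.
  exists 1 => // b /andP[+ _]; have /andP[_ b1] := Delta01 q01 qsum b.
  by rewrite ltNge b1.
exists (Num.min d1 d2); first by rewrite lt_min d10.
move=> y; rewrite /= in_itv /= lt_min.
move=> /preferred_exists[b pb] /andP[/ltr_normlP[h3 h4] /ltr_normlP[h5 h6]].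
have [xy|yx|->] := ltgtP x y; last by rewrite subrr normr0.
  by rewrite (f_E pb); apply: h2; rewrite -pb.1 xy /=; lra.
by rewrite (f_E pb); apply: h1; rewrite -pb.1 yx andbT; lra.
Qed.

(** If [x] were an end of one of the cylinders of its representation, without
being 0 or 1, the tail would be constant and produce a twin. *)
Lemma continuous_unary x : Qunary q x ->
  continuous_on_at `[0, 1] (f_ q a) x.
Proof.
move=> [x01 [alpha [e uniq]]].
have fx : f_ q a x = Delta q (digit_dist alpha).
  have [b pb] := preferred_exists x01.
  by rewrite (f_E pb) (uniq b pb.1).
apply: (continuous_two_sided e e fx fx).
  have [|/existsNP[n]] := pselect (forall n, lo q alpha n < x); first by left.
  move=> /negP; rewrite -leNgt => xlo; right.
  have /(lo_const q01 qsum) t : lo q alpha n = Delta q alpha.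
    by apply/eqP; rewrite eq_le -e xlo e (lo_le_Delta q01 qsum).
  have [z|[m [nz z]]] := last_exception t.
    by rewrite e (zero_tail q01 qsum shrink (n := 0)) ?lo0.
  have tw := twins_lower nz z; have [_ + _ _] := tw.
  rewrite -(uniq _ (etrans e (esym (twins_Delta q01 qsum shrink tw)))).
  by move/eqP; rewrite ltn_eqF.
have [|/existsNP[n]] := pselect (forall n, x < hi q alpha n); first by left.
move=> /negP; rewrite -leNgt => xhi; right.
have /(hi_const q01 qsum) t : hi q alpha n = Delta q alpha.
  by apply/eqP; rewrite eq_le -e xhi e (Delta_le_hi q01 qsum).
have [z|[m [nz z]]] := last_exception t.
  by rewrite e (max_tail q01 qsum shrink (n := 0)) ?hi0.
have tw := twins_upper nz z; have [_ + _ _] := tw.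
rewrite -(uniq _ (etrans e (twins_Delta q01 qsum shrink tw))).
by move/eqP; rewrite ltn_eqF.
Qed.

Lemma twins_lo_lt m alpha gamma : twins m alpha gamma ->
  forall n, lo q alpha n < Delta q alpha.
Proof.
move=> [_ _ t _] n; rewrite lt_neqAle (lo_le_Delta q01 qsum) andbT.
apply/negP => /eqP/(lo_const q01 qsum)/(_ _ (leq_maxl n m.+1)).
by rewrite t ?leq_maxr.
Qed.

Lemma twins_lt_hi m alpha gamma : twins m alpha gamma ->
  forall n, Delta q gamma < hi q gamma n.
Proof.
move=> [_ _ _ t] n; rewrite lt_neqAle (Delta_le_hi q01 qsum) andbT eq_sym.
apply/negP => /eqP/(hi_const q01 qsum)/(_ _ (leq_maxl n m.+1)).
by rewrite t ?leq_maxr.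
Qed.

(** [f_] takes the value of the upper twin, which is also the limit from the
right; the limit from the left is the value of the image of the lower twin. *)
Lemma continuous_binary m alpha gamma : twins m alpha gamma ->
  continuous_on_at `[0, 1] (f_ q a) (Delta q gamma) <->
  Delta q (digit_dist alpha) = Delta q (digit_dist gamma).
Proof.
move=> tw; have e := twins_Delta q01 qsum shrink tw.
have fx : f_ q a (Delta q gamma) = Delta q (digit_dist gamma).
  by apply/f_E/(@preferred_zero_tail m); case: tw.
split=> [/continuous_on_atP c|ed]; last first.
  apply: (@continuous_two_sided _ alpha gamma) => //; first by rewrite ed.
    by left; rewrite -e; apply: twins_lo_lt tw.
  by left; apply: twins_lt_hi tw.
apply/eqP; rewrite -subr_eq0 -normr_eq0 eq_le normr_ge0 andbT.
apply/ler_addgt0Pr => r r0; rewrite add0r.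
have r20 : 0 < r / 2 by rewrite divr_gt0.
have [d d0 hd] := c _ r20.
have [d' d'0 hd'] :=
  left_limit q01 qsum shrink digit_dist_agree (twins_lo_lt tw) r20.
rewrite e in hd'; move: c hd hd' fx; set x := Delta q gamma => _ hd hd' fx.
have x0 : 0 < x by rewrite /x -e -(lo0 q alpha) (twins_lo_lt tw).
have x1 : x <= 1 by have /andP[] := Delta01 q01 qsum gamma.
pose w := Num.min x (Num.min d d').
have w0 : 0 < w by rewrite /w !lt_min x0 d0 d'0.
have /andP[wx /andP[wd wd']] : (w <= x) && ((w <= d) && (w <= d')).
  by rewrite /w !ge_min !lexx !orbT.
(* A point left of [x], close enough for continuity and for the left limit. *)
have y01 : 0 <= x - w / 2 <= 1 by lra.
have [b pb] := preferred_exists y01.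
have := hd (x - w / 2); rewrite fx (f_E pb) /= in_itv /= => /(_ y01).
have := hd' b; rewrite -pb.1 => h1 h2.
have {}h1 := h1 ltac:(lra); have {}h2 := h2 ltac:(rewrite ltr_norml; lra).
apply: ltW; rewrite (splitr r).
apply: le_lt_trans (ler_distD (Delta q (digit_dist b)) _ _) _.
by rewrite ltrD // distrC.
Qed.

End DigitDistance.

(** * The s-adic expansion as a case of equal weights *)

Section UniformWeights.
Variables (R : realType) (p : nat).
Implicit Type alpha : digits p.+2.

Let u : 'I_p.+2 -> nat -> R := fun _ _ => p.+2%:R^-1.

Let u01 i n : 0 < u i n < 1.
Proof. by rewrite invr_gt0 ltr0n invf_lt1 ?ltr0n // ltr1n. Qed.

Let usum n : \sum_(i < p.+2) u i n = 1.
Proof. by rewrite sumr_const card_ord -[LHS]mulr_natr mulVf ?pnatr_eq0. Qed.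

Let wd_uE alpha n : wd u alpha n = p.+2%:R^-1 ^+ n.
Proof. by rewrite /wd prodr_const card_ord. Qed.

Let u_shrink alpha : wd u alpha n @[n --> \oo] --> (0 : R).
Proof.
under eq_fun do rewrite wd_uE.
have /andP[u0 u1] := u01 ord0 0.
by apply: cvg_expr; rewrite gtr0_norm.
Qed.

Lemma sadicE alpha : sadic R alpha = Delta u alpha.
Proof.
rewrite /sadic /Delta; congr (limn (series _)); apply/funext => n.
rewrite -/(wd u alpha n) wd_uE /beta.
rewrite -(big_ord_widen _ (fun=> p.+2%:R^-1 : R) (ltnW (ltn_ord (alpha n)))).
by rewrite sumr_const card_ord [RHS]mulrnAl -[RHS]mulr_natl -exprVn exprS.
Qed.

Lemma sadic_eq0 alpha : sadic R alpha = 0 <-> forall n, alpha n = ord0.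
Proof.
rewrite sadicE -(lo0 u alpha); split=> [/esym/(lo_const u01 usum) h n|h].
  exact: h.
by apply: zero_tail => // n _.
Qed.

Lemma sadic_eq1 alpha : sadic R alpha = 1 <-> forall n, alpha n = ord_max.
Proof.
rewrite sadicE -(hi0 u alpha); split=> [/esym/(hi_const u01 usum) h n|h].
  exact: h.
by apply: max_tail => // n _.
Qed.

End UniformWeights.

Lemma maxq_shrink (R : realType) (p : nat) (q : 'I_p.+2 -> nat -> R) :
  (forall i n, 0 < q i n < 1) ->
  (fun N => \prod_(n < N) maxq q n) @ \oo --> (0 : R) ->
  forall alpha : digits p.+2, wd q alpha n @[n --> \oo] --> (0 : R).
Proof.
move=> q01 qprod alpha; apply: squeeze_cvgr (cvg_cst 0) qprod.
apply: nearW => n; rewrite (ltW (wd_gt0 q01 alpha n)) /=.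
apply: ler_prod => j _; rewrite (ltW (q_gt0 q01 _ _)) /=.
exact: (@le_bigmax _ _ _ 0 (fun i => q i j) (alpha j)).
Qed.

(** * Which parameters preserve twins *)

Section Criterion.
Variables (R : realType) (p : nat) (q : 'I_p.+2 -> nat -> R).
Hypothesis q01 : forall i n, 0 < q i n < 1.
Hypothesis qsum : forall n, \sum_(i < p.+2) q i n = 1.
Hypothesis shrink : forall alpha, wd q alpha n @[n --> \oo] --> (0 : R).
Variable a : digits p.+2.
Implicit Types alpha gamma : digits p.+2.

Lemma digit_dist_zero alpha :
  (forall n, a n = ord0) -> digit_dist a alpha = alpha.
Proof.
move=> a0; apply/funext => n; apply: val_inj.
by rewrite /= a0 /= sub0n subn0.
Qed.

(** The distance to the largest digit reverses the order of digits, and so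
exchanges the roles of twins. *)
Lemma digit_dist_max_twins m alpha gamma : (forall n, a n = ord_max) ->
  twins m alpha gamma -> twins m (digit_dist a gamma) (digit_dist a alpha).
Proof.
move=> a1 [h e t1 t2]; split.
- exact/digit_dist_agree/agree_sym.
- rewrite /= a1 /= e; have := ltn_ord (gamma m); lia.
- by move=> n /t2 tn; apply: val_inj; rewrite /= tn a1 /= subn0 sub0n addn0.
- by move=> n /t1 tn; apply: val_inj; rewrite /= tn a1 /= subnn.
Qed.

(** The distances of [a 0] to [c] and to [c - 1] differ by exactly 1.  If the
numbers represented by the images agree, the images are twins, and which of the
two distances is larger decides which image ends in zeros. *)
Lemma first_digit_test (c : 'I_p.+2) : c != ord0 ->
  (forall x, Qbinary q x -> continuous_on_at `[0, 1] (f_ q a) x) ->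
  ((a 0 < c)%N /\ forall n, (0 < n)%N -> a n = ord0) \/
  ((c <= a 0)%N /\ forall n, (0 < n)%N -> a n = ord_max).
Proof.
move=> c0 C; pose gamma : digits p.+2 := fun n => if n is 0%N then c else ord0.
have tw : twins 0 (lower_twin 0 gamma) gamma by apply: twins_lower => // -[].
have /(continuous_binary q01 qsum shrink a tw) := C _ (twins_Qbinary q tw).
set alpha := lower_twin 0 gamma in tw *.
case: tw => _ /= e t1 _.
move=> /(Delta_eq q01 qsum)[E|[m tm]].
  by have := congr1 (fun g => nat_of_ord (g 0%N)) E; rewrite /= e; lia.
(* The first digits of the images differ, so the images can only be twins
   at position 0. *)
have m0 : m = 0%N.
  case: m tm => // m.
  by case=> -[/(_ 0%N isT)/(congr1 val) /= + _ _ _]; rewrite e; lia.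
move: tm; rewrite {}m0.
move=> -[[_ d s1 s2]|[_ d s1 s2]]; move: d; rewrite /= e => d.
  left; split; first by lia.
  move=> n n0; have /(congr1 val) := s2 n n0.
  case: n n0 => // n _ /= h; apply: val_inj => /=; lia.
right; split; first by lia.
move=> n n0; have /(congr1 val) := s1 n n0.
case: n n0 => // n _ /= h; apply: val_inj => /=; lia.
Qed.

End Criterion.

Theorem theorem1 (R : realType) (s : nat) (hs : (2 <= s)%N)
    (q : 'I_s -> nat -> R)
    (q01 : forall i n, 0 < q i n < 1)
    (qsum : forall n, \sum_(i < s) q i n = 1)
    (qprod : (fun N => \prod_(n < N) maxq q n) @ \oo --> (0 : R))
    (eps delta : R)
    (eps_gt0 : 0 < eps) (delta_lt1 : delta < 1)
    (eps_minq : forall n, eps < minq q n)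
    (maxq_delta : forall n, maxq q n < delta)
    (a : R) (ad : digits s) (a_ad : a = sadic R ad) :
  (forall x : R, Qunary q x -> continuous_on_at `[0, 1] (f_ q ad) x) /\
  ((forall x : R, Qbinary q x -> continuous_on_at `[0, 1] (f_ q ad) x)
   <-> a = 0 \/ a = 1).
Proof.
case: s hs q q01 qsum qprod eps_minq maxq_delta ad a_ad => [//|[//|p]] _.
move=> q q01 qsum qprod _ _ ad ->.
have shrink := maxq_shrink q01 qprod.
split; first by move=> x; apply: continuous_unary.
rewrite sadic_eq0 sadic_eq1; split=> [C|ad01 x].
  have c1 : inord 1 != ord0 :> 'I_p.+2 by rewrite -val_eqE /= inordK.
  have [[a0 t]|[_ t]] := first_digit_test q01 qsum shrink c1 C.
    left=> -[|n]; last exact: t.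
    by apply: val_inj => /=; move: a0; rewrite inordK //; lia.
  (* The tail of [ad] is largest, so testing with the largest [c] forces [ad 0]
     to be largest as well. *)
  have [[_ t0]|[top _]] :=
      first_digit_test q01 qsum shrink (c := ord_max) isT C.
    by have := t 1%N isT; rewrite t0.
  right=> -[|n]; last exact: t.
  by apply: val_inj => /=; move: top => /=; have := ltn_ord (ad 0%N); lia.
move=> [gamma [m [gm0 t ->]]].
have tw : twins m (lower_twin m gamma) gamma.
  apply: twins_lower => [|n /t h]; last exact: val_inj.
  by rewrite -val_eqE /= -lt0n.
apply/(continuous_binary q01 qsum shrink ad tw).
case: ad01 => [ad0|ad1].
  by rewrite !digit_dist_zero ?(twins_Delta q01 qsum shrink tw).
exact/esym/(twins_Delta q01 qsum shrink (digit_dist_max_twins ad1 tw)).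
Qed.
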